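(* Let $p \geq 5$ be a prime and assume that $-1,2,3\in \mathcal{S}(p)$. Then there exist graphs $X_4$ and $X_5$ such that any graph can be decomposed into $K_1$, $K_2$, $K_3$, $X_4$ and $X_5$ over $\mathbb{F}_p$.
   Context: Graphs are finite, undirected and simple. A graph $X$ is identified with its adjacency matrix (entry $1$ at $(u,v)$ if $uv$ is an edge, $0$ otherwise), regarded as a matrix over the field under consideration. For a prime $p$, $\mathbb{F}_p$ is the field with $p$ elements, $\mathbb{F}_p^\times=\mathbb{F}_p\setminus\{0\}$, and $\mathcal{S}(p)=\{a^2 : a\in\mathbb{F}_p^\times\}$; integers are regarded as elements of $\mathbb{F}_p$ by reduction mod $p$. For square matrices, $M\oplus M'$ denotes the block diagonal matrix with blocks $M,M'$, and $nM$ denotes the direct sum $M\oplus\cdots\oplus M$ of $n$ copies of $M$. Symmetric matrices $M,M'$ over a field $k$ are called similar over $k$, written $M\sim M'$, if there is an invertible matrix $P$ over $k$ with $M'=P^tMP$ (i.e. they are congruent). A graph $X$ can be decomposed into graphs $X_1,\dots,X_s$ over $k$ if $X\sim n_1X_1\oplus\cdots\oplus n_sX_s$ over $k$ for some integers $n_i\geq 0$. $K_n$ is the complete graph on $n$ vertices. The graphs $X_4,X_5$ may depend on $p$ but not on the graph being decomposed. *)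

(* Defs.v *)
From mathcomp Require Import all_boot all_algebra.
Set Implicit Arguments.
Unset Strict Implicit.
Unset Printing Implicit Defensive.
Import GRing.Theory.
Local Open Scope ring_scope.

Record graph := Graph {
  vertex : finType;
  edge : rel vertex;
  edge_sym : symmetric edge;
  edge_irrefl : irreflexive edge
}.

Definition complete_rel n : rel 'I_n := fun u v => u != v.

Lemma complete_rel_sym n : symmetric (@complete_rel n).
Proof. by move=> u v; rewrite /complete_rel eq_sym. Qed.

Lemma complete_rel_irrefl n : irreflexive (@complete_rel n).
Proof. by move=> u; rewrite /complete_rel eqxx. Qed.

Definition complete_graph n : graph :=
  Graph (@complete_rel_sym n) (@complete_rel_irrefl n).

(* Rows and columns follow the standard enumeration of the vertices; another
   ordering would give a congruent matrix. *)
Definition adjmx (k : fieldType) (X : graph) : 'M[k]_#|vertex X| :=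
  \matrix_(i, j) (@edge X (enum_val i) (enum_val j))%:R.

(* The relation M' = P^t M P. The sizes m and m' need not be syntactically
   equal, so equality of sizes is part of the relation. *)
Definition mx_congruent (k : fieldType) m m' (M : 'M[k]_m) (M' : 'M[k]_m') : Prop :=
  exists (e : m' = m) (P : 'M[k]_m),
    P \in unitmx /\ castmx (e, e) M' = P^T *m M *m P.

Definition copies (k : fieldType) m (n : nat) (M : 'M[k]_m) :
  'M[k]_(\sum_(j < n) m) := \mxdiag_(j < n) M.

Definition decomposable (k : fieldType) (X : graph) s (Y : 'I_s -> graph) :
  Prop :=
  exists n : 'I_s -> nat,
    mx_congruent (adjmx k X) (\mxdiag_(i < s) copies (n i) (adjmx k (Y i))).

(* A 5-tuple of graphs would be a universe inconsistency, since [graph]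
   quantifies over finite types. *)
Definition family5 (Y1 Y2 Y3 Y4 Y5 : graph) (i : 'I_5) : graph :=
  match val i with
  | 0 => Y1 | 1 => Y2 | 2 => Y3 | 3 => Y4 | _ => Y5
  end.

Definition nonzero_squares (p : nat) : {set 'F_p} :=
  [set a ^+ 2 | a : 'F_p & a != 0].

(* Main.v *)
(* A symmetric form over a finite field of odd characteristic is determined up
   to congruence by its dimension, its rank [r] and its discriminant [d] modulo
   squares. For a graph, a nonsingular principal submatrix of size [r] shows
   that [r] and [d] are also those of an induced subgraph on [r] vertices with
   nonsingular adjacency matrix; in particular [r] is never 1. As -1 and 2 are
   squares, [K_2] and [K_3] have square discriminants and ranks 2 and 3, so they
   provide every rank other than 1 with square discriminant. Let [n] be the
   least order of a graph with nonsingular adjacency matrix of nonsquare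
   determinant: [X_4] is such a graph of order [n], [X_5] one of order [n + 1]
   if there is one, and larger ranks come from [X_4] with [K_2] and [K_3]. *)

Require Import Defs.
From Stdlib Require Import Classical_Prop Wf_nat.
From mathcomp Require Import all_boot all_fingroup all_algebra all_solvable.
From mathcomp Require Import ring zify.
Set Implicit Arguments.
Unset Strict Implicit.
Unset Printing Implicit Defensive.
Import GRing.Theory.
Local Open Scope ring_scope.

Definition is_square (R : pzRingType) (a : R) := exists c, a = c ^+ 2.

(** * Squares in a finite field *)

Section Squares.
Variable F : finFieldType.

Lemma is_square_dec (a : F) : is_square a \/ ~ is_square a.
Proof.
have [/existsP[c /eqP ac]|sqFa] := boolP [exists c, a == c ^+ 2].
  by left; exists c.
by right=> -[c ac]; case/existsP: sqFa; exists c; apply/eqP.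
Qed.

(** The unit group is cyclic and nonsquares are odd powers of a generator, so a product of two of
    them is an even power. *)
Lemma mul_nonsquare (a b : F) :
  ~ is_square a -> ~ is_square b -> is_square (a * b).
Proof.
have nz (c : F) : ~ is_square c -> c \is a GRing.unit.
  move=> sqFc; rewrite unitfE; apply/eqP => c0.
  by apply: sqFc; exists 0; rewrite c0 expr0n.
move=> sqFa sqFb.
have /cyclicP[g genG] := field_unit_group_cyclic [set: {unit F}].
have odd_exp (u : {unit F}) :
    ~ is_square (val u) -> exists k, val u = val g ^+ k.*2.+1.
  move=> sqFu; have /cycleP[k uk] : u \in <[g]>%g by rewrite -genG inE.
  have vk : val u = val g ^+ k by rewrite uk FinRing.val_unitX.
  exists k./2; rewrite vk; case: (boolP (odd k)) => [ok|/negPf ek].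
    by rewrite -[in LHS](odd_double_half k) ok.
  case: sqFu; exists (val g ^+ k./2); rewrite vk -exprM muln2.
  by rewrite -[in LHS](odd_double_half k) ek.
have [j /= aj] := odd_exp (FinRing.Unit (nz a sqFa)) sqFa.
have [k /= bk] := odd_exp (FinRing.Unit (nz b sqFb)) sqFb.
exists (val g ^+ (j + k).+1); rewrite aj bk -exprD -exprM; congr (_ ^+ _); lia.
Qed.

Lemma binary_form_represents1 (i a b : F) : i ^+ 2 = -1 -> 2 != 0 :> F ->
  a != 0 -> b != 0 -> exists x y, a * x ^+ 2 + b * y ^+ 2 = 1.
Proof.
move=> i2 F2 a0 b0.
have i0 : i != 0.
  apply/eqP => ie; move/eqP: i2.
  by rewrite ie expr0n eq_sym oppr_eq0 oner_eq0.
have sqP (c : F) : c != 0 -> is_square c -> exists x, c * x ^+ 2 = 1.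
  move=> c0 [s cs]; exists s^-1; rewrite cs exprVn divff //.
  by rewrite -cs.
have [/(sqP _ a0)[x ax]|sqFa] := is_square_dec a.
  by exists x, 0; rewrite ax expr0n mulr0 addr0.
have [/(sqP _ b0)[x bx]|sqFb] := is_square_dec b.
  by exists 0, x; rewrite bx expr0n mulr0 add0r.
have [c abc] := mul_nonsquare sqFa sqFb.
have c0 : c != 0.
  by apply/eqP => c0; move: (mulf_neq0 a0 b0); rewrite abc c0 expr0n eqxx.
(* [a b = c^2] turns the form into [a (x^2 + (c y / a)^2)], and
   [x^2 + z^2 = (x + i z) (x - i z)] takes every value. *)
have F4 : 4 != 0 :> F by rewrite (natrM _ 2 2) mulf_neq0.
(* With [z = c y / a], these values solve [x + i z = 1 / a] and [x - i z = 1]. *)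
exists ((a^-1 + 1) / 2), (a / c * ((a^-1 - 1) / (2 * i))).
have -> : b = c ^+ 2 / a by rewrite -abc mulrAC mulfV ?mul1r.
have -> : c ^+ 2 / a * (a / c * ((a^-1 - 1) / (2 * i))) ^+ 2 =
  a * (a^-1 - 1) ^+ 2 / (2 ^+ 2 * i ^+ 2).
  by field; rewrite i0 F4 a0 F2.
rewrite i2; field.
by rewrite oppr_eq0 F4 a0 F2.
Qed.

End Squares.

(** * Congruence of matrices and orthogonal splitting *)

Section Congruence.
Variable F : fieldType.

(** The rows of [P] are the new basis vectors; in [mx_congruent] the columns are. *)
Definition congruent n (A B : 'M[F]_n) :=
  exists2 P, P \in unitmx & B = P *m A *m P^T.

Lemma congruent_sym n (A B : 'M[F]_n) : congruent A B -> congruent B A.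
Proof.
case=> P uP ->; exists (invmx P); first by rewrite unitmx_inv.
by rewrite trmx_inv !mulmxA mulVmx // mul1mx mulmxK // unitmx_tr.
Qed.

Lemma congruent_trans n (A B C : 'M[F]_n) :
  congruent A B -> congruent B C -> congruent A C.
Proof.
case=> P uP -> [Q uQ ->]; exists (Q *m P); first by rewrite unitmx_mul uQ.
by rewrite trmx_mul !mulmxA.
Qed.

Lemma congruent_trmx n (A B : 'M[F]_n) : congruent A B -> A^T = A -> B^T = B.
Proof. by case=> P _ -> sA; rewrite !trmx_mul trmxK sA mulmxA. Qed.

Lemma congruent_det n (A B : 'M[F]_n) :
  congruent A B -> exists2 c, c != 0 & \det B = c ^+ 2 * \det A.
Proof.
case=> P uP ->; exists (\det P); first by rewrite -unitfE -unitmxE.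
by rewrite !det_mulmx det_tr mulrAC expr2.
Qed.

Lemma congruent_block n1 n2 (A : 'M[F]_n1) (B B' : 'M[F]_n2) :
  congruent B B' -> congruent (block_mx A 0 0 B) (block_mx A 0 0 B').
Proof.
case=> P uP ->; exists (block_mx 1%:M 0 0 P).
  by rewrite unitmxE det_ublock det1 mul1r -unitmxE.
rewrite tr_block_mx !trmx0 trmx1 !mulmx_block.
by rewrite !(mul1mx, mul0mx, mulmx0, mulmx1, addr0, add0r).
Qed.

Lemma congruent_block_trmx n1 n2 (A : 'M[F]_(n1 + n2)) B C :
  congruent A (block_mx B 0 0 C) -> A^T = A -> C^T = C.
Proof.
move=> cA /(congruent_trmx cA); rewrite tr_block_mx => /eq_block_mx.
by case.
Qed.

(** Both row spaces are the whole space. This serves to complete a vector to a basis and to match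
    two embeddings of a core. *)
Lemma row_full_translate m n (U V : 'M[F]_(m, n)) : row_full U -> row_full V ->
  exists2 P, P \in unitmx & U = P *m V.
Proof. by move=> fU fV; apply/eqmxMunitP; rewrite !submx_full. Qed.

(** Completing [v] to a basis puts [a] in the corner; one step of Gaussian elimination then clears
    the rest of its row and column. *)
Lemma symmetric_split n (A : 'M[F]_(1 + n)) (v : 'rV_(1 + n)) (a : F) :
    A^T = A -> a != 0 -> v *m A *m v^T = a%:M ->
  exists B : 'M_n, congruent A (block_mx a%:M 0 0 B).
Proof.
move=> sA a0 vAv.
have fv : row_full v^T.
  apply/row_fullP; exists (a^-1 *: (v *m A)).
  by rewrite -scalemxAl vAv scale_scalar_mx mulVf.
have fe : row_full (row_mx 1%:M 0 : 'M[F]_(1, 1 + n))^T.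
  apply/row_fullP; exists (row_mx 1%:M 0).
  by rewrite tr_row_mx mul_row_col trmx0 trmx1 mulmx1 mulmx0 addr0.
have [P uP vP] := row_full_translate fv fe.
have {vP} vP : v = row_mx 1%:M 0 *m P^T.
  by rewrite -[LHS]trmxK vP trmx_mul trmxK.
have cAB : congruent A (P^T *m A *m P) by exists P^T; rewrite ?unitmx_tr ?trmxK.
set B := P^T *m A *m P in cAB.
have sB : B^T = B := congruent_trmx cAB sA.
have Bul : ulsubmx B = a%:M.
  have -> : a%:M = row_mx 1%:M 0 *m B *m (row_mx 1%:M 0)^T.
    by rewrite -vAv vP trmx_mul trmxK /B !mulmxA.
  rewrite -[in RHS](submxK B) tr_row_mx trmx0 trmx1.
  by rewrite mul_row_block mul_row_col !(mul1mx, mul0mx, mulmx0, mulmx1, addr0).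
have Bur : ursubmx B = (dlsubmx B)^T by rewrite trmx_dlsub sB.
pose L : 'M[F]_(1 + n) := block_mx 1%:M 0 (- a^-1 *: dlsubmx B) 1%:M.
(* This is the Schur complement of the corner entry [a]. *)
exists (drsubmx B - a^-1 *: (dlsubmx B *m (dlsubmx B)^T)).
apply: (congruent_trans cAB); exists L.
  by rewrite unitmxE det_lblock !det1 mulr1 unitr1.
rewrite -[in RHS](submxK B) Bul Bur /L tr_block_mx !trmx0 !trmx1 !mulmx_block.
rewrite !(mul1mx, mul0mx, mulmx0, mulmx1, addr0, add0r).
rewrite mul_mx_scalar mul_scalar_mx [(_ *: _)^T]linearZ /= !scalerA mulrN divff //.
rewrite !scaleN1r !addNr mul0mx add0r -scalemxAl scaleNr.
by rewrite [_ + drsubmx B]addrC.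
Qed.

(** Polarization: if the quadratic form vanishes on the basis vectors and on their pairwise sums,
    then [2 * A i j = 0] for all [i], [j]. *)
Lemma symmetric_represents_nonzero n (A : 'M[F]_n) : 2 != 0 :> F ->
  A^T = A -> A != 0 -> exists (v : 'rV_n) (a : F), a != 0 /\ v *m A *m v^T = a%:M.
Proof.
move=> F2 sA A0; pose q (v : 'rV_n) : F := (v *m A *m v^T) 0 0.
have [/forallP q0|] := boolP [forall i, forall j,
  (q (delta_mx 0 i) == 0) && (q (delta_mx 0 i + delta_mx 0 j) == 0)].
  case/eqP: A0; apply/matrixP=> i j; rewrite mxE.
  have qe k l :
      ((delta_mx 0 k : 'rV_n) *m A *m (delta_mx 0 l : 'rV_n)^T) 0 0 = A k l.
    by rewrite trmx_delta -rowE -colE !mxE.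
  have addE (X Y : 'M[F]_1) : (X + Y) 0 0 = X 0 0 + Y 0 0 by rewrite mxE.
  have /forallP/(_ j)/andP[/eqP qi /eqP qij] := q0 i.
  have /forallP/(_ j)/andP[/eqP qj _] := q0 j.
  move: qij; rewrite /q linearD /= !mulmxDl !mulmxDr !addE !qe.
  rewrite /q !qe in qi qj; rewrite qi qj add0r addr0.
  have -> : A j i = A i j by rewrite -{1}sA mxE.
  rewrite -mulr2n -mulr_natl => /eqP.
  by rewrite mulf_eq0 (negPf F2) => /eqP.
rewrite negb_forall => /existsP[i]; rewrite negb_forall => /existsP[j].
by rewrite negb_and => /orP[] q0;
  by move: q0; set v := (v in q v); exists v, (q v); split=> //;
  apply: mx11_scalar.
Qed.

End Congruence.

(** * Classification of nonsingular symmetric matrices by discriminant *)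

Section Classification.
Variables (F : finFieldType) (i : F).
Hypotheses (i2 : i ^+ 2 = -1) (F2 : 2 != 0 :> F).

(** Two successive splittings exhibit a plane with diagonal form [a], [b], and this plane contains a
    vector of value 1. *)
Lemma symmetric_split1 n (A : 'M[F]_(1 + n.+1)) : A^T = A -> \det A != 0 ->
  exists B : 'M_n.+1, congruent A (block_mx 1%:M 0 0 B).
Proof.
move=> sA A0.
have nz m (C : 'M[F]_m.+1) : \det C != 0 -> C != 0.
  by apply: contraNneq => ->; rewrite det0.
have [v [a [a0 va]]] := symmetric_represents_nonzero F2 sA (nz _ _ A0).
have [B cAB] := symmetric_split sA a0 va.
have sB := congruent_block_trmx cAB sA.
have B0 : \det B != 0.
  have [c c0 /eqP] := congruent_det cAB; rewrite det_ublock.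
  by apply: contraTneq => ->; rewrite mulr0 eq_sym mulf_neq0 // expf_neq0.
have [w [b [b0 wb]]] := symmetric_represents_nonzero F2 sB (nz _ _ B0).
have [x [y xy]] := binary_form_represents1 i2 F2 a0 b0.
have [P uP eP] := cAB.
(* The vector has coordinates [x] and [y *: w] in the basis formed by the rows of [P]. *)
apply: (@symmetric_split _ _ A (row_mx x%:M (y *: w) *m P)) => //.
  exact: oner_neq0.
rewrite trmx_mul !mulmxA -[_ *m P *m A]mulmxA -[_ *m _ *m P^T]mulmxA -eP.
rewrite tr_row_mx mul_row_block mul_row_col tr_scalar_mx linearZ /=.
rewrite !(mulmx0, addr0, add0r) -!scalar_mxM -!scalemxAl -scalemxAr wb.
by rewrite !scale_scalar_mx -raddfD -xy; congr _%:M; ring.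
Qed.

(** Induction on the order: once 1 is split off both matrices, the determinants of the complements
    still differ by a square factor. Order 1 is a rescaling by [c]. *)
Lemma congruent_of_det n (A B : 'M[F]_n) c : A^T = A -> B^T = B ->
  \det A != 0 -> \det B != 0 -> \det B = c ^+ 2 * \det A -> congruent A B.
Proof.
elim: n A B c => [|[|n] IH] A B c sA sB A0 B0 dAB.
- by exists 1%:M; rewrite ?unitmx1 //; apply/matrixP => -[].
- have c0 : c != 0 by apply: contraNneq B0 => c0; rewrite dAB c0 expr0n mul0r.
  exists c%:M; first by rewrite unitmxE det_scalar1 unitfE.
  rewrite [A]mx11_scalar [B]mx11_scalar in dAB *.
  rewrite !det_scalar1 in dAB.
  by rewrite dAB tr_scalar_mx -!scalar_mxM; congr _%:M; ring.
have [A1 cA] := symmetric_split1 sA A0; have [B1 cB] := symmetric_split1 sB B0.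
apply: (congruent_trans cA); apply: congruent_trans (congruent_sym cB).
have [a a0 dA] := congruent_det cA; have [b b0 dB] := congruent_det cB.
rewrite !det_ublock !det1 !mul1r in dA dB.
have sA1 := congruent_block_trmx cA sA.
have sB1 := congruent_block_trmx cB sB.
apply: congruent_block; apply: (IH _ _ (b * c / a)) => //.
- by rewrite dA mulf_neq0 // expf_neq0.
- by rewrite dB mulf_neq0 // expf_neq0.
by rewrite dA dB dAB; field.
Qed.

End Classification.

(** * Nondegenerate cores of symmetric matrices *)

Section Core.
Variable F : fieldType.

(* [M] is, up to congruence, the orthogonal sum of a nondegenerate form of
   rank [r] and discriminant [d] and of a zero form. *)
Definition has_core m (M : 'M[F]_m) r d := exists (U : 'M[F]_(m, r)) D,
  [/\ row_full U, D^T = D, \det D = d, d != 0 & M = U *m D *m U^T].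

Lemma has_core_leq m (M : 'M[F]_m) r d : has_core M r d -> (r <= m)%N.
Proof. by case=> U [D [fU _ _ _ _]]; rewrite -(eqP fU) rank_leq_row. Qed.

Lemma has_core_castmx m m' (e : m = m') (M : 'M[F]_m) r d :
  has_core M r d -> has_core (castmx (e, e) M) r d.
Proof. by case: m' / e; rewrite castmx_id. Qed.

Lemma has_core0 m : has_core (0 : 'M[F]_m) 0 1.
Proof.
exists 0, 0; split; rewrite ?trmx0 ?det_mx00 ?oner_neq0 ?mulmx0 ?mul0mx //.
by rewrite -col_leq_rank.
Qed.

Lemma has_core_block m1 m2 (M1 : 'M[F]_m1) (M2 : 'M[F]_m2) r1 r2 d1 d2 :
    has_core M1 r1 d1 -> has_core M2 r2 d2 ->
  has_core (block_mx M1 0 0 M2) (r1 + r2) (d1 * d2).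
Proof.
case=> U1 [D1 [/row_fullP[V1 VU1] s1 <- d1n ->]].
case=> U2 [D2 [/row_fullP[V2 VU2] s2 <- d2n ->]].
exists (block_mx U1 0 0 U2), (block_mx D1 0 0 D2); split.
- apply/row_fullP; exists (block_mx V1 0 0 V2).
  by rewrite mulmx_block !(mulmx0, mul0mx, addr0, add0r) VU1 VU2 -scalar_mx_block.
- by rewrite tr_block_mx !trmx0 s1 s2.
- by rewrite det_ublock.
- exact: mulf_neq0.
by rewrite tr_block_mx !trmx0 !mulmx_block !(mulmx0, mul0mx, addr0, add0r).
Qed.

Lemma has_core_mxdiag n (m r : 'I_n -> nat) (d : 'I_n -> F)
    (M : forall i, 'M[F]_(m i)) : (forall i, has_core (M i) (r i) (d i)) ->
  has_core (\mxdiag_i M i) (\sum_i r i) (\prod_i d i).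
Proof.
elim: n m r d M => [|n IH] m r d M cM.
  suff -> : \mxdiag_i M i = 0.
    by rewrite [(\sum_i r i)%N]big_ord0 [\prod_i _]big_ord0; apply: has_core0.
  have size0 : (\sum_i m i = 0)%N by exact: big_ord0.
  by apply/matrixP=> i; suff: (i < 0)%N by []; rewrite -[X in (_ < X)%N]size0.
rewrite mxdiag_recl [(\sum_i r i)%N]big_ord_recl [\prod_i _]big_ord_recl.
apply: has_core_castmx.
by apply: has_core_block => //; apply: IH.
Qed.

(* The rows of [A] indexed by [f] form a basis of its row space, so that
   [A = U *m rowsub f A]; by symmetry [A = U *m mxsub f f A *m U^T]. *)
Lemma symmetric_core m (A : 'M[F]_m) : A^T = A ->
  exists r (f : 'I_r -> 'I_m), has_core A r (\det (mxsub f f A)).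
Proof.
move=> sA; have [r [f [rA freeB /submxP[U AU]]]] : exists r (f : 'I_r -> 'I_m),
    [/\ \rank A = r, row_free (rowsub f A) & (A <= rowsub f A)%MS].
  exists (\rank A), (maxrankfun A); rewrite maxrowsub_free.
  by rewrite eq_maxrowsub submx_refl.
exists r, f; move: AU; set B := rowsub f A; set D := mxsub f f A => AU.
have BD : B = D *m U^T.
  rewrite /B -[in LHS]sA {1}AU trmx_mul -mul_rowsub_mx /B trmx_mxsub sA.
  by rewrite -mxsub_comp.
exists U, D; split.
- by rewrite -col_leq_rank -[X in (X <= _)%N]rA AU mxrankM_maxl.
- by rewrite trmx_mxsub sA.
- by [].
(* [B] has rank [r] and factors through [D], so [D] is nonsingular. *)
- rewrite -unitfE -unitmxE -row_free_unit -row_leq_rank.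
  by rewrite -[X in (X <= _)%N](eqP freeB) -/B BD mxrankM_maxl.
by rewrite -mulmxA -BD.
Qed.

(** * Cores of adjacency matrices *)

Definition relmx n (e : rel 'I_n) : 'M[F]_n := \matrix_(i, j) (e i j)%:R.

Lemma adjmx_trmx (X : graph) : (adjmx F X)^T = adjmx F X.
Proof. by apply/matrixP=> i j; rewrite !mxE edge_sym. Qed.

(** A principal submatrix of an adjacency matrix is the adjacency matrix of an induced subgraph, so
    the discriminant is itself realized by a graph of order [r]. *)
Lemma graph_core (X : graph) : exists r (e : rel 'I_r),
  [/\ symmetric e, irreflexive e & has_core (adjmx F X) r (\det (relmx e))].
Proof.
have [r [f cX]] := symmetric_core (adjmx_trmx X).
exists r, (fun i j => edge (enum_val (f i)) (enum_val (f j))); split.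
- by move=> i j; rewrite edge_sym.
- by move=> i; rewrite edge_irrefl.
suff <- : mxsub f f (adjmx F X) =
  relmx (fun i j => edge (enum_val (f i)) (enum_val (f j))) by [].
by apply/matrixP=> i j; rewrite !mxE.
Qed.

(** The core is the whole matrix; [U] is the permutation matrix of the vertex enumeration, which
    also bridges the sizes [#|'I_n|] and [n]. *)
Lemma ord_graph_core n (e : rel 'I_n) (es : symmetric e) (ei : irreflexive e) :
  \det (relmx e) != 0 -> has_core (adjmx F (Graph es ei)) n (\det (relmx e)).
Proof.
move=> e0; pose g : 'I_#|'I_n| -> 'I_n := enum_val.
exists (rowsub g 1%:M), (relmx e); split => //.
- apply/row_fullP; exists (rowsub enum_rank 1%:M).
  rewrite mul_rowsub_mx mul1mx -mxsub_comp.
  by apply/matrixP=> i j; rewrite !mxE /= /g enum_rankK.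
- by apply/matrixP=> i j; rewrite !mxE es.
rewrite mul_rowsub_mx mul1mx trmx_mxsub trmx1 mulmx_colsub mulmx1 -mxsub_comp.
by apply/matrixP=> i j; rewrite !mxE.
Qed.

Lemma det_mx22 (A : 'M[F]_2) :
  \det A = A ord0 ord0 * A ord_max ord_max - A ord0 ord_max * A ord_max ord0.
Proof.
rewrite (expand_det_row _ ord0) !big_ord_recl big_ord0 /cofactor !det_mx11 !mxE.
have [e0 e1] :
    lift ord0 ord0 = ord_max :> 'I_2 /\ lift ord_max ord0 = ord0 :> 'I_2.
  by split; apply: val_inj.
by rewrite /= -[lift ord0 0]/(lift ord0 ord0 : 'I_2) e0 e1; ring.
Qed.

Lemma complete2_core : has_core (adjmx F (complete_graph 2)) 2 (-1).
Proof.
have d2 : \det (relmx (@complete_rel 2)) = -1.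
  by rewrite det_mx22 !mxE /=; ring.
by rewrite -d2; apply: ord_graph_core; rewrite d2 oppr_eq0 oner_neq0.
Qed.

Lemma complete3_core : 2 != 0 :> F -> has_core (adjmx F (complete_graph 3)) 3 2.
Proof.
have d3 : \det (relmx (@complete_rel 3)) = 2.
  rewrite (expand_det_row _ 0) !big_ord_recl big_ord0 /cofactor.
  by rewrite !det_mx22 !mxE /=; ring.
by move=> F2; rewrite -d3; apply: ord_graph_core; rewrite d3.
Qed.

(** Copies of [K_1] supply the radical of the form. *)
Lemma complete1_core : has_core (adjmx F (complete_graph 1)) 0 1.
Proof.
suff -> : adjmx F (complete_graph 1) = 0 by exact: has_core0.
apply/matrixP=> i j; rewrite !mxE /= /complete_rel.
by rewrite !(ord1 (enum_val _)).
Qed.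

(** This excludes rank 1, which copies of [K_2] and [K_3] cannot reach. *)
Lemma relmx_det_order1 (e : rel 'I_1) : irreflexive e -> \det (relmx e) = 0.
Proof. by move=> ei; rewrite det_mx11 mxE ei. Qed.

End Core.

(** * Decomposition of graphs *)

Section Decomposition.
Variables (F : finFieldType) (i : F).
Hypotheses (i2 : i ^+ 2 = -1) (F2 : 2 != 0 :> F).

(** The cores are congruent by the classification, and their embeddings, both of full column rank,
    then differ by an invertible left factor. *)
Lemma mx_congruent_of_core m m' (M : 'M[F]_m) (M' : 'M[F]_m') r d d' :
    m' = m -> has_core M r d -> has_core M' r d' -> is_square (d * d') ->
  mx_congruent M M'.
Proof.
move=> e; case: m / e M => M.
case=> U [D [fU sD <- D0 ->]] [U' [D' [fU' sD' <- D'0 ->]]] [c dd].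
have dD : \det D' = (c / \det D) ^+ 2 * \det D.
  by rewrite expr_div_n -dd; field.
have [P uP ->] := congruent_of_det i2 F2 sD sD' D0 D'0 dD.
have fUP : row_full (U' *m P).
  by rewrite -col_leq_rank mxrankMfree ?row_free_unit // col_leq_rank.
have [G uG UG] := row_full_translate fUP fU.
exists erefl, G^T; rewrite unitmx_tr castmx_id trmxK; split=> //.
transitivity ((U' *m P) *m D *m (U' *m P)^T); first by rewrite trmx_mul !mulmxA.
by rewrite UG trmx_mul !mulmxA.
Qed.

Variable s : F.
Hypothesis s2 : s ^+ 2 = 2.

(** [t] is the rank left to [K_2] and [K_3]. Their discriminants [-1 = i ^+ 2] and [2 = s ^+ 2] are
    squares, so only [X4] and [X5] affect the square class. *)
Lemma decomposable_of_core (X X4 X5 : graph) r d d4 d5 t n4 n5 :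
    has_core (adjmx F X) r d ->
    has_core (adjmx F X4) #|vertex X4| d4 ->
    has_core (adjmx F X5) #|vertex X5| d5 ->
    (r = t + #|vertex X4| * n4 + #|vertex X5| * n5)%N -> t != 1%N ->
    is_square (d * (d4 ^+ n4 * d5 ^+ n5)) ->
  decomposable F X
    (family5 (complete_graph 1) (complete_graph 2) (complete_graph 3) X4 X5).
Proof.
move=> cX c4 c5 rE t1 [c cE].
(* One [K_3] corrects the parity; an odd [t] is at least 3, so the truncated subtraction is
   exact. *)
pose n3 : nat := odd t; pose n2 := ((t - 3 * n3)./2)%N.
have tE : (t = 2 * n2 + 3 * n3)%N by rewrite /n2 /n3; lia.
pose n1 := (#|vertex X| - r)%N; have rX := has_core_leq cX.
pose n (j : 'I_5) := nth 0%N [:: n1; n2; n3; n4; n5] j.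
pose rk (j : 'I_5) := nth 0%N [:: 0; 2; 3; #|vertex X4|; #|vertex X5|]%N j.
pose dd (j : 'I_5) := nth 0 [:: 1; -1; 2; d4; d5] j.
have cY : has_core
    (\mxdiag_j copies (n j) (adjmx F (family5 (complete_graph 1)
      (complete_graph 2) (complete_graph 3) X4 X5 j)))
    (\sum_j \sum_(l < n j) rk j) (\prod_j \prod_(l < n j) dd j).
  apply: has_core_mxdiag => j; apply: has_core_mxdiag => _.
  case: j => -[|[|[|[|[|//]]]]] ? //=.
  - exact: complete1_core.
  - exact: complete2_core.
  - exact: complete3_core.
have eR : (\sum_j \sum_(l < n j) rk j)%N = r.
  rewrite !big_ord_recl big_ord0 !sum_nat_const !card_ord /n /rk /= rE tE; ring.
have eD : \prod_j \prod_(l < n j) dd j =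
    (i ^+ n2 * s ^+ n3) ^+ 2 * (d4 ^+ n4 * d5 ^+ n5).
  rewrite !big_ord_recl big_ord0 !prodr_const !card_ord /n /dd /=.
  by rewrite expr1n exprMn -!exprM ![(_ * 2)%N]mulnC !exprM i2 s2; ring.
rewrite eR eD in cY; exists n; apply: mx_congruent_of_core cX cY _.
  rewrite !big_ord_recl big_ord0 !sum_nat_const !card_ord /n /family5 /=.
  by rewrite -[RHS](subnK rX) -/n1 rE tE; ring.
by exists (i ^+ n2 * s ^+ n3 * c); rewrite mulrCA cE; ring.
Qed.

Definition nonsquare_order n := exists e : rel 'I_n,
  [/\ symmetric e, irreflexive e, \det (relmx F e) != 0
    & ~ is_square (\det (relmx F e))].

Lemma nonsquare_graph n : exists (Y : graph) d,
  has_core (adjmx F Y) #|vertex Y| d /\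
  (nonsquare_order n -> #|vertex Y| = n /\ ~ is_square d).
Proof.
have [[e [es ei e0 sqFe]]|noe] := classic (nonsquare_order n).
  exists (Graph es ei), (\det (relmx F e)); split; last by split; first exact: card_ord.
  by rewrite [X in has_core _ X]card_ord; apply: ord_graph_core.
(* A default with a core of full order, taken with multiplicity 0 in the decompositions below. *)
exists (complete_graph 2), (-1); split=> //.
by rewrite [X in has_core _ X]card_ord; apply: complete2_core.
Qed.

Lemma least_nonsquare_order : exists n, forall m,
  nonsquare_order m -> nonsquare_order n /\ (n <= m)%N.
Proof.
have [exm|nom] := classic (exists m, nonsquare_order m); last first.
  (* With no such order the claim is vacuous and 0 is arbitrary. *)
  by exists 0%N => m om; case: nom; exists m.
have [n [[on n_min] _]] := dec_inh_nat_subset_has_unique_least_element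
  nonsquare_order (fun m => classic _) exm.
by exists n => m om; split=> //; apply/leP/n_min.
Qed.

Lemma decomposition_five_graphs : exists X4 X5 : graph, forall X : graph,
  decomposable F X
    (family5 (complete_graph 1) (complete_graph 2) (complete_graph 3) X4 X5).
Proof.
have [n n_min] := least_nonsquare_order.
have [X4 [d4 [c4 X4n]]] := nonsquare_graph n.
have [X5 [d5 [c5 X5n]]] := nonsquare_graph n.+1.
exists X4, X5 => X; have [r [e [es ei cX]]] := graph_core F X.
have e0 : \det (relmx F e) != 0 by case: cX => U [D []].
have [[c dc]|sqFd] := is_square_dec (\det (relmx F e)).
  apply: (decomposable_of_core (t := r) (n4 := 0) (n5 := 0) cX c4 c5).
  - by rewrite !muln0 !addn0.
  - apply: contraNneq e0 => r1; move: e ei {es cX dc}; rewrite r1 => e ei.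
    by rewrite relmx_det_order1.
  - by exists c; rewrite !mulr1.
have or : nonsquare_order r by exists e.
have [on n_le_r] := n_min r or.
have [X4n' sqFd4] := X4n on.
(* For [r = n + 1], using [X4] would leave rank 1; [X5] fills the whole rank instead. *)
have [rn|rn] := eqVneq r n.+1.
  have [X5n' sqFd5] : #|vertex X5| = n.+1 /\ ~ is_square d5.
    by apply: X5n; rewrite -rn.
  apply: (decomposable_of_core (t := 0) (n4 := 0) (n5 := 1) cX c4 c5) => //.
    by rewrite X5n' rn muln0 muln1.
  by rewrite expr0 mul1r; apply: mul_nonsquare.
(* Here [r - n] is 0 or at least 2. *)
apply: (decomposable_of_core (t := r - n) (n4 := 1) (n5 := 0) cX c4 c5).
- by rewrite X4n' muln0 muln1 addn0 subnK.
- lia.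
- by rewrite expr0 mulr1; apply: mul_nonsquare.
Qed.

End Decomposition.

Theorem theorem4 (p : nat) (p_prime : prime p) (p_ge5 : (5 <= p)%N)
    (sqN1 : -1 \in nonzero_squares p)
    (sq2 : 2 \in nonzero_squares p)
    (sq3 : 3 \in nonzero_squares p) :
  exists X4 X5 : graph, forall X : graph,
    decomposable 'F_p
      X (family5 (complete_graph 1) (complete_graph 2) (complete_graph 3) X4 X5).
Proof.
have /imsetP[i _ iE] := sqN1; have /imsetP[s s0 sE] := sq2.
(* 2 is the square of the nonzero element [s]. *)
have F2 : 2 != 0 :> 'F_p by rewrite sE expf_neq0 //; move: s0; rewrite inE.
exact (decomposition_five_graphs (esym iE) F2 (esym sE)).
Qed.
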